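(* The smallest tensor rank function $r_*$ has the max-full-rank-subtensor property.
   Context: $\mathbf{Z}_+$ is the set of nonnegative integers and $\mathbf{N}$ the set of positive integers. For $m,n_1,\dots,n_m\in\mathbf{N}$, $\mathbf{T}(n_1,\dots,n_m)$ is the set of real $m$th order tensors $\mathcal{X}=(x_{i_1\cdots i_m})$ of dimension $n_1\times\cdots\times n_m$; $\mathbf{CT}(m,n)$ is the case $n_1=\cdots=n_m=n$; $\mathbf{T}$ is the set of all real tensors (all orders $m\ge1$, all dimensions). A tensor $\mathcal{X}\in\mathbf{T}(n_1,\dots,n_m)$ is rank-one if $\mathcal{X}=\mathbf{x}^{(1)}\circ\cdots\circ\mathbf{x}^{(m)}$ (outer product) with nonzero $\mathbf{x}^{(i)}\in\mathbb{R}^{n_i}$. The identity tensor $\mathcal{I}_{m,n}\in\mathbf{CT}(m,n)$ has entries $1$ when $i_1=\cdots=i_m$ and $0$ otherwise. A subtensor of $\mathcal{X}\in\mathbf{T}(n_1,\dots,n_m)$ is a tensor of the same order $m$ obtained by choosing nonempty index sets $T_l\subseteq\{1,\dots,n_l\}$, $l=1,\dots,m$, and restricting $\mathcal{X}$ to $T_1\times\cdots\times T_m$; it is an element of $\mathbf{T}(|T_1|,\dots,|T_m|)$. A function $r:\mathbf{T}\to\mathbf{Z}_+$ is a tensor rank function if: (1) $r(\mathcal{X})=0$ iff $\mathcal{X}$ is a zero tensor, and $r(\mathcal{X})=1$ iff $\mathcal{X}$ is a rank-one tensor; (2) $r(\mathcal{I}_{m,n})=n$ for all $m,n\in\mathbf{N}$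 with $m\ge2$; (3) for $\mathcal{X}\in\mathbf{T}(n_1,n_2,1,\dots,1)$ (order at least $2$), $r(\mathcal{X})$ equals the matrix rank of the $n_1\times n_2$ matrix corresponding to $\mathcal{X}$; (4) $r(\alpha\mathcal{X})=r(\mathcal{X})$ for every tensor $\mathcal{X}$ and real $\alpha\ne0$; (5) $r(\mathcal{Y})=r(\mathcal{X})$ whenever $\mathcal{Y}$ is obtained from $\mathcal{X}$ by permuting its modes, i.e. $\sigma$ is a permutation of the $m$ coordinates, $\mathcal{Y}$ has dimensions $\sigma(n_1,\dots,n_m)$, and the entry of $\mathcal{Y}$ at position $\sigma(i_1,\dots,i_m)$ is $x_{i_1\cdots i_m}$; (6) $r(\mathcal{Y})\le r(\mathcal{X})$ whenever $\mathcal{Y}$ is a subtensor of $\mathcal{X}$. The smallest tensor rank function $r_*$ is the unique tensor rank function with $r_*(\mathcal{X})\le r(\mathcal{X})$ for every tensor rank function $r$ and every $\mathcal{X}\in\mathbf{T}$; explicitly, $r_*(\mathcal{X})=\min\{r(\mathcal{X}): r\text{ is a tensor rank function}\}$. Full rank: for a tensor rank function $r$, a tensor $\mathcal{X}\in\mathbf{T}(n_1,\dots,n_m)$ is of full $r$ rank if $r(\mathcal{X})=n_p$ for some index $p$ with $1\le p\le m$; in addition, zero tensors are regarded as being of full $r$ rank. A subtensor $\mathcal{Y}$ of $\mathcal{X}$ is a maximum full rank subtensor of $\mathcal{X}$ under $r$ if $\mathcal{Y}$ is of full $r$ rank and $r(\mathcal{Y})$ is the maximum of $r$ over all subtensors of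 $\mathcal{X}$ that are of full $r$ rank. The function $r$ has the max-full-rank-subtensor property if for every $\mathcal{X}\in\mathbf{T}$, $r(\mathcal{X})=r(\mathcal{Y})$ where $\mathcal{Y}$ is a maximum full rank subtensor of $\mathcal{X}$ under $r$. *)

(* Defs.v *)
From HB Require Import structures.
From mathcomp Require Import all_boot all_order all_algebra all_fingroup.
From mathcomp Require Import boolp classical_sets reals.

Set Implicit Arguments.
Unset Strict Implicit.
Unset Printing Implicit Defensive.
Import Order.TTheory GRing.Theory Num.Theory.
Local Open Scope ring_scope.

(* The set T of all real tensors: any order m >= 1 and any positive
   dimensions.  A position (i_1, ..., i_m) is a dependent function
   l |-> i_l; modes and entries are numbered from 0. *)
Record tensor (R : realType) := Tensor {
  tdeg : nat;
  tdim : 'I_tdeg -> nat;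
  tentry :> (forall l : 'I_tdeg, 'I_(tdim l)) -> R;
  tdeg_gt0 : (0 < tdeg)%N;
  tdim_gt0 : forall l, (0 < tdim l)%N }.

Arguments tdim {R} X l : rename.
Arguments tentry {R} X i : rename.
Arguments tdim_gt0 {R} X l : rename.

Definition zero_tensor (R : realType) (X : tensor R) : Prop :=
  forall i, X i = 0.

Definition rank_one_tensor (R : realType) (X : tensor R) : Prop :=
  exists x : forall l : 'I_(tdeg X), 'rV[R]_(tdim X l),
    (forall l, x l != 0) /\ (forall i, X i = \prod_l x l 0 (i l)).

Definition identity_tensor (R : realType) (m n : nat)
    (m_gt0 : (0 < m)%N) (n_gt0 : (0 < n)%N) : tensor R :=
  @Tensor R m (fun=> n)
    (fun i => [forall k, forall l, i k == i l]%:R) m_gt0 (fun=> n_gt0).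

Definition scale_tensor (R : realType) (a : R) (X : tensor R) : tensor R :=
  @Tensor R (tdeg X) (tdim X) (fun i => a * X i)
    (tdeg_gt0 X) (tdim_gt0 X).

(* The tensor Y with dimensions n_(s 0), ..., n_(s (m-1)) whose entry at
   position l |-> i_(s l) is the entry of X at position i; equivalently, the
   entry at j is the entry of X at l |-> j_(s^-1 l). *)
Definition permute_modes (R : realType) (X : tensor R)
    (s : 'S_(tdeg X)) : tensor R :=
  @Tensor R (tdeg X) (fun l => tdim X (s l))
    (fun j => X (fun l =>
       cast_ord (congr1 (tdim X) (permKV s l)) (j ((s^-1)%g l))))
    (tdeg_gt0 X) (fun l => tdim_gt0 X (s l)).

Lemma permute_modesE (R : realType) (X : tensor R) (s : 'S_(tdeg X))
    (i : forall l : 'I_(tdeg X), 'I_(tdim X l)) :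
  permute_modes s (fun l => i (s l)) = X i.
Proof.
rewrite /=; congr (tentry X _); apply: functional_extensionality_dep => l.
by apply: val_inj => /=; rewrite permKV.
Qed.

Lemma card_set_gt0 (n : nat) (A : {set 'I_n}) : A != finset.set0 -> (0 < #|A|)%N.
Proof. by rewrite card_gt0. Qed.

(* The restriction of X to S_1 x ... x S_m, each S_l being renumbered
   increasingly (enum_val). *)
Definition subtensor (R : realType) (X : tensor R)
    (S : forall l : 'I_(tdeg X), {set 'I_(tdim X l)})
    (S_neq0 : forall l, S l != finset.set0) : tensor R :=
  @Tensor R (tdeg X) (fun l => #|S l|)
    (fun i => X (fun l => enum_val (i l)))
    (tdeg_gt0 X) (fun l => card_set_gt0 (S_neq0 l)).

Definition is_subtensor (R : realType) (Y X : tensor R) : Prop :=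
  exists (S : forall l : 'I_(tdeg X), {set 'I_(tdim X l)})
         (S_neq0 : forall l, S l != finset.set0), Y = subtensor S_neq0.

Record tensor_rank_function (R : realType) (r : tensor R -> nat) : Prop := {
  trf_zero : forall X, r X = 0%N <-> zero_tensor X;
  trf_one : forall X, r X = 1%N <-> rank_one_tensor X;
  trf_identity : forall (m n : nat) (m_gt0 : (0 < m)%N) (n_gt0 : (0 < n)%N),
    (2 <= m)%N -> r (identity_tensor R m_gt0 n_gt0) = n;
  (* l0 and l1 are the first two modes; when all other dimensions are 1, the
     matrix A corresponding to X is the only one satisfying the equation. *)
  trf_matrix : forall (X : tensor R) (l0 l1 : 'I_(tdeg X))
      (A : 'M[R]_(tdim X l0, tdim X l1)),
    l0 = 0%N :> nat -> l1 = 1%N :> nat ->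
    (forall l : 'I_(tdeg X), (2 <= l)%N -> tdim X l = 1%N) ->
    (forall i, X i = A (i l0) (i l1)) ->
    r X = \rank A;
  trf_scale : forall (a : R) (X : tensor R), a != 0 ->
    r (scale_tensor a X) = r X;
  trf_permute : forall (X : tensor R) (s : 'S_(tdeg X)),
    r (permute_modes s) = r X;
  trf_subtensor : forall X Y : tensor R, is_subtensor Y X -> (r Y <= r X)%N }.

(* The minimum of r X over all tensor rank functions r; the default value 0 of
   xget would only be used if there were no tensor rank function (there are
   some: the CP rank, or the largest rank of a mode flattening). *)
Definition smallest_rank (R : realType) (X : tensor R) : nat :=
  xget 0%N [set k : nat |
    (exists r, tensor_rank_function r /\ r X = k) /\
    (forall r, tensor_rank_function r -> (k <= r X)%N)]%classic.

Definition full_rank (R : realType) (r : tensor R -> nat) (X : tensor R)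
    : Prop :=
  (exists p : 'I_(tdeg X), r X = tdim X p) \/ zero_tensor X.

Definition max_full_rank_subtensor (R : realType) (r : tensor R -> nat)
    (X Y : tensor R) : Prop :=
  [/\ is_subtensor Y X, full_rank r Y &
      forall Z, is_subtensor Z X -> full_rank r Z -> (r Z <= r Y)%N].

Definition max_full_rank_subtensor_property (R : realType)
    (r : tensor R -> nat) : Prop :=
  forall X, exists Y, max_full_rank_subtensor r X Y /\ r X = r Y.

(* Main.v *)
(* The largest rank of a mode flattening is a tensor rank function bounded by
   the largest dimension, so the smallest rank r is attained at each tensor, is
   itself a tensor rank function, and has the same bound.  Let r' X be the
   largest r Y over the subtensors Y of X that are of full r rank, so r' <= r.
   Then r' is again a tensor rank function, and minimality of r gives r' = r.
   The delicate axiom is that r' X = 1 forces X to be of rank one: a nonzero X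
   is of rank one iff X_i X_j is unchanged when i and j swap one coordinate, so
   otherwise X has a subtensor with all dimensions at most 2, one of them equal
   to 2, that is not of rank one; its r rank is 2, hence full. *)

Require Import Defs.
From mathcomp Require Import boolp classical_sets reals.
From mathcomp Require Import all_boot all_order all_algebra all_fingroup.

Set Implicit Arguments.
Unset Strict Implicit.
Unset Printing Implicit Defensive.
Import Order.TTheory GRing.Theory Num.Theory.
Local Open Scope ring_scope.

(** * Increasing enumerations, and operations on subtensors *)

Lemma ltn_sorted_enum n (A : {pred 'I_n}) :
  sorted (fun x y : 'I_n => (x < y)%N) (enum A).
Proof.
rewrite {1}/enum_mem -enumT; apply: sorted_filter => [? ? ?|].
  exact: ltn_trans.
have : sorted ltn (map val (enum 'I_n)) by rewrite val_enum_ord iota_ltn_sorted.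
by rewrite sorted_map.
Qed.

(** A finite set of ordinals has only one increasing enumeration. This identifies the renumbering by
    [enum_val] in a subtensor with any other increasing one, such as the identity or the composite
    of two renumberings. *)
Lemma homo_enum_val n (A : {set 'I_n}) k (f : 'I_k -> 'I_n) :
  {homo f : i j / (i < j)%N} -> A = [set f i | i in 'I_k] ->
  forall (i : 'I_k) (j : 'I_#|A|), i = j :> nat -> f i = enum_val j.
Proof.
move=> fmono defA i j eq_ij.
have ltT : transitive (fun x y : 'I_n => (x < y)%N).
  by move=> ? ? ?; exact: ltn_trans.
have lt_irr : irreflexive (fun x y : 'I_n => (x < y)%N) by move=> ?; exact: ltnn.
have defE : map f (enum 'I_k) = enum A.
  apply: (irr_sorted_eq ltT lt_irr); last 1 first.
  - move=> x; rewrite mem_enum defA; apply/mapP/imsetP => -[y _ ->];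
      by exists y; rewrite // mem_enum.
  - by rewrite sorted_map; apply: sub_sorted (ltn_sorted_enum _) => x y; exact: fmono.
  - exact: ltn_sorted_enum.
rewrite (enum_val_nth (f i)) -defE -eq_ij (nth_map i) ?size_enum_ord //.
by rewrite nth_ord_enum.
Qed.

Lemma ltn_enum_val n (A : {set 'I_n}) :
  {homo @enum_val _ (mem A) : i j / (i < j)%N}.
Proof.
move=> i j lt_ij; have x0 := enum_val i; rewrite !(enum_val_nth x0).
have ltT : transitive (fun x y : 'I_n => (x < y)%N).
  by move=> ? ? ?; exact: ltn_trans.
by apply: (sorted_ltn_nth ltT _ (ltn_sorted_enum _)) => //; rewrite inE -cardE.
Qed.

(** Dimensions that are only provably equal give positions of different types. Comparing coordinates
    as natural numbers avoids transporting the entries along an equality of dimensions. *)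
Lemma tensor_eq (R : realType) (m : nat) (d1 d2 : 'I_m -> nat)
    (e1 : (forall l, 'I_(d1 l)) -> R) (e2 : (forall l, 'I_(d2 l)) -> R)
    (m1 m2 : (0 < m)%N) (p1 : forall l, (0 < d1 l)%N)
    (p2 : forall l, (0 < d2 l)%N) :
  d1 =1 d2 ->
  (forall (i1 : forall l, 'I_(d1 l)) (i2 : forall l, 'I_(d2 l)),
     (forall l, i1 l = i2 l :> nat) -> e1 i1 = e2 i2) ->
  Tensor e1 m1 p1 = Tensor e2 m2 p2.
Proof.
move/funext => eq_d; move: e2 p2; rewrite -eq_d => e2 p2 eq_e.
have -> : e2 = e1 by apply/funext => i; rewrite (eq_e i i).
by congr Tensor; apply: Prop_irrelevance.
Qed.

Lemma is_subtensor_refl (R : realType) (X : tensor R) : is_subtensor X X.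
Proof.
have T_neq0 (l : 'I_(tdeg X)) : [set: 'I_(tdim X l)] != set0.
  by apply/set0Pn; exists (Ordinal (tdim_gt0 X l)); rewrite in_setT.
exists (fun l => [set: 'I_(tdim X l)]), T_neq0.
case: X T_neq0 => m d e m0 d0 T0 /=.
apply: tensor_eq => [l|i j eq_ij] /=; first by rewrite cardsT card_ord.
congr e; apply: functional_extensionality_dep => l.
apply: (homo_enum_val (f := id)) => //.
by apply/setP => x; rewrite in_setT; apply/esym/imsetP; exists x.
Qed.

Lemma is_subtensor_trans (R : realType) (X Y Z : tensor R) :
  is_subtensor Z Y -> is_subtensor Y X -> is_subtensor Z X.
Proof.
move=> [T [T0 ->]] [S [S0 defY]]; move: T T0; rewrite {}defY => T T0.
pose U (l : 'I_(tdeg X)) := [set @enum_val _ (mem (S l)) x | x in T l].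
have U0 l : U l != set0.
  have /set0Pn[x Tx] := T0 l; apply/set0Pn; exists (enum_val x).
  exact: imset_f.
exists U, U0; apply: tensor_eq => [l|i j eq_ij] /=.
  by rewrite card_imset //; apply: enum_val_inj.
congr (tentry X _); apply: functional_extensionality_dep => l.
apply: (homo_enum_val (f := fun x => enum_val (enum_val x))) => //.
  by move=> x y lt_xy; do 2 apply: ltn_enum_val.
apply/setP => x; apply/imsetP/imsetP => -[y Ty ->].
  by exists (enum_rank_in Ty y); rewrite // enum_rankK_in.
by exists (enum_val y) => //; exact: enum_valP.
exact: eq_ij.
Qed.

Lemma is_subtensor_scale (R : realType) (X Y : tensor R) a :
  is_subtensor Y X -> is_subtensor (scale_tensor a Y) (scale_tensor a X).
Proof. by move=> [S [S0 ->]]; exists S, S0. Qed.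

Lemma scale_tensorK (R : realType) (X : tensor R) a :
  a != 0 -> scale_tensor a^-1 (scale_tensor a X) = X.
Proof.
case: X => m d e m0 d0 a0; apply: tensor_eq => //= i j eq_ij.
rewrite mulKf //; congr e; apply: functional_extensionality_dep => l.
exact/val_inj/eq_ij.
Qed.

(** Restriction enumerates index sets while permutation of modes casts indices; this commutation
    lets the two operations be exchanged. *)
Lemma cast_enum_val (I : Type) (d : I -> nat) (A : forall l, {set 'I_(d l)})
    (k l : I) (e : k = l) (i : 'I_#|A k|) :
  enum_val (cast_ord (congr1 (fun l => #|A l|) e) i) =
  cast_ord (congr1 d e) (enum_val i).
Proof. by case: l / e; rewrite !cast_ord_id. Qed.

Lemma is_subtensor_permute (R : realType) (X : tensor R)
    (S : forall l : 'I_(tdeg X), {set 'I_(tdim X l)})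
    (S_neq0 : forall l, S l != set0) (s : 'S_(tdeg X)) :
  is_subtensor (@permute_modes R (subtensor S_neq0) s) (permute_modes s).
Proof.
exists (fun l => S (s l)), (fun l => S_neq0 (s l)).
apply: tensor_eq => // i j eq_ij /=.
congr (tentry X _); apply: functional_extensionality_dep => l.
rewrite -cast_enum_val; congr enum_val; exact/val_inj/eq_ij.
Qed.

Lemma permute_modesK (R : realType) (X : tensor R) (s : 'S_(tdeg X)) :
  @permute_modes R (permute_modes s) s^-1%g = X.
Proof.
case: X s => m d e m0 d0 s; apply: tensor_eq => [l|i j eq_ij] /=.
  by rewrite permKV.
congr e; apply: functional_extensionality_dep => l.
apply: val_inj; rewrite /= eq_ij /=.
(* The two coordinates of [j] lie in different ordinal types, so the equality of modes is applied to
   their values in [nat]. *)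
exact: (congr1 (fun k => j k : nat) (permK (s^-1)%g l)).
Qed.

(** * Mode flattenings *)

Notation position X := (forall l : 'I_(tdeg X), 'I_(tdim X l)).

Lemma dfwith_id (I : eqType) (T : I -> Type) (f : forall i, T i) (l : I) :
  dfwith f (f l) = f.
Proof.
apply: functional_extensionality_dep => k.
by case: (eqVneq l k) => [<-|lk]; rewrite ?dfwith_in ?dfwith_out.
Qed.

Lemma dfwith_dfwith (I : eqType) (T : I -> Type) (f : forall i, T i) (l : I)
    (x y : T l) : dfwith (dfwith f x) y = dfwith f y.
Proof.
apply: functional_extensionality_dep => k.
by case: (eqVneq l k) => [<-|lk]; rewrite ?dfwith_in ?dfwith_out.
Qed.

(** These are the quadratic equations of the Segre variety: all 2 x 2 minors of all mode flattenings
    vanish. *)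
Definition exchange (R : realType) (X : tensor R) : Prop :=
  forall (l : 'I_(tdeg X)) (i j : position X),
    X i * X j = X (dfwith i (j l)) * X (dfwith j (i l)).

Lemma zero_tensorPn (R : realType) (X : tensor R) :
  ~ zero_tensor X -> exists i, X i != 0.
Proof. by move=> /existsNP[i /eqP]; exists i. Qed.

Lemma rank_one_exchange (R : realType) (X : tensor R) :
  rank_one_tensor X -> exchange X.
Proof.
move=> [x [_ Xx]] l i j; rewrite !Xx -!big_split; apply: eq_bigr => k _ /=.
case: (eqVneq l k) => [<-|lk]; last by rewrite !dfwith_out.
by rewrite !dfwith_in mulrC.
Qed.

Lemma rank_one_neq0 (R : realType) (X : tensor R) :
  rank_one_tensor X -> ~ zero_tensor X.
Proof.
move=> [x [x_neq0 Xx]] X0.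
have x_ex l : exists a, x l 0 a != 0 by apply/rV0Pn.
have /eqP := X0 (fun l => sval (cid (x_ex l))); rewrite Xx.
by apply/negP/prodf_neq0 => l _; case: cid.
Qed.

(** Start from a nonzero entry, at [i0], and move to [i] one coordinate at a time. By the exchange
    identity, changing coordinate [l] multiplies the entry by [f l (i l)], which depends on that
    coordinate alone. *)
Lemma exchange_rank_one (R : realType) (X : tensor R) :
  ~ zero_tensor X -> exchange X -> rank_one_tensor X.
Proof.
move=> /zero_tensorPn[i0 Xi0] exX.
pose f l (a : 'I_(tdim X l)) := X (dfwith i0 a) / X i0.
pose mix (s : seq _) (i : position X) : position X :=
  fun l => if l \in s then i l else i0 l.
have mixE s i : uniq s -> X (mix s i) = X i0 * \prod_(l <- s) f l (i l).
  elim: s => [_|l s IHs /= /andP[ls us]].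
    by rewrite big_nil mulr1; congr (tentry X _); exact: functional_extensionality_dep.
  (* After multiplication by [X i0], the positions [mix (l :: s) i] and [i0] swap their coordinate
     [l], which leaves [mix s i] and a position on the fiber through [i0]. *)
  apply: (mulIf Xi0); rewrite (exX l) big_cons.
  rewrite {2}/mix mem_head mulrCA -(IHs us) /f mulrAC divfK // mulrC.
  congr (_ * tentry X _); apply: functional_extensionality_dep => k.
  case: (eqVneq l k) => [<-|lk]; first by rewrite dfwith_in /mix (negPf ls).
  by rewrite dfwith_out // /mix in_cons eq_sym (negPf lk).
have f1 l : f l (i0 l) = 1 by rewrite /f dfwith_id divff.
pose l0 := Ordinal (tdeg_gt0 X).
(* The scalar [X i0] must occur once in the product, so it is put into the factor of the first
   mode. *)
exists (fun l => \row_a ((if l == l0 then X i0 else 1) * f l a)).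
split=> [l|i].
  apply/rV0Pn; exists (i0 l); rewrite mxE f1 mulr1; case: ifP => // _.
  exact: oner_neq0.
under eq_bigr do rewrite mxE.
rewrite big_split /= -big_mkcond big_pred1_eq -mixE ?index_enum_uniq //.
congr (tentry X _); apply: functional_extensionality_dep => l.
by rewrite /mix mem_index_enum.
Qed.

(** The maps [f] and [g] need not be injective: repeating rows or columns does not raise the
    rank. *)
Lemma mxrank_le_entries (F : fieldType) m n p q (A : 'M[F]_(m, n))
    (B : 'M[F]_(p, q)) (f : 'I_p -> 'I_m) (g : 'I_q -> 'I_n) :
  (forall a b, B a b = A (f a) (g b)) -> (\rank B <= \rank A)%N.
Proof.
move=> BA; have -> : B = rowsub f (colsub g A) by apply/matrixP => a b; rewrite !mxE.
apply: leq_trans (mxrankS (rowsub_sub _ _)) _.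
by rewrite -mxrank_tr trmx_mxsub -[leqRHS]mxrank_tr mxrankS // rowsub_sub.
Qed.

(** In the factorization of [A] through its rank, the inner dimension is 0 or 1, so each entry is
    zero or a product of a row scalar and a column scalar. *)
Lemma mxrank_le1_minor (F : fieldType) m n (A : 'M[F]_(m, n)) a a' b b' :
  (\rank A <= 1)%N -> A a b * A a' b' = A a b' * A a' b.
Proof.
rewrite -{2 3 4 5}(mulmx_base A).
move: (\rank A) (col_base A) (row_base A) => [|[|r]] // C D _; rewrite !mxE.
  by rewrite !big_ord0 mul0r.
by rewrite !big_ord1 mulrACA [D _ _ * _]mulrC mulrACA.
Qed.

(* The columns are indexed by all positions, whose l-th coordinate is ignored:
   this repeats columns but leaves the rank unchanged. *)
Definition flattening (R : realType) (X : tensor R) (l : 'I_(tdeg X)) :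
    'M[R]_(tdim X l, #|{dffun forall k : 'I_(tdeg X), 'I_(tdim X k)}|) :=
  \matrix_(a, c) X (dfwith (enum_val c : {dffun _}) a).

Arguments flattening {R} X l.

Definition flattening_rank (R : realType) (X : tensor R) : nat :=
  \max_(l < tdeg X) \rank (flattening X l).

Definition column_of (R : realType) (X : tensor R) (i : position X) :
    'I_#|{dffun forall k : 'I_(tdeg X), 'I_(tdim X k)}| :=
  enum_rank (finfun i : {dffun forall k : 'I_(tdeg X), 'I_(tdim X k)}).

Lemma flatteningE (R : realType) (X : tensor R) l a (i : position X) :
  flattening X l a (column_of i) = X (dfwith i a).
Proof.
rewrite mxE enum_rankK; congr (tentry X (dfwith _ a)).
by apply: functional_extensionality_dep => k; rewrite ffunE.
Qed.

Lemma flattening_rank_le (R : realType) (X : tensor R) n :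
  (forall l, (\rank (flattening X l) <= n)%N) -> (flattening_rank X <= n)%N.
Proof. by move=> le_n; apply/bigmax_leqP => l _; exact: le_n. Qed.

Lemma le_flattening_rank (R : realType) (X : tensor R) l :
  (\rank (flattening X l) <= flattening_rank X)%N.
Proof. exact: (leq_bigmax (F := fun l => \rank (flattening X l))). Qed.

Lemma mxrank_le_flattening (R : realType) (X : tensor R) (l : 'I_(tdeg X)) m n
    (A : 'M[R]_(m, n)) (f : 'I_m -> 'I_(tdim X l)) (g : 'I_n -> position X) :
  (forall a b, A a b = X (dfwith (g b) (f a))) ->
  (\rank A <= \rank (flattening X l))%N.
Proof.
move=> AX; apply: (@mxrank_le_entries _ _ _ _ _ _ _ f (fun b => column_of (g b))).
by move=> a b; rewrite flatteningE.
Qed.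

(** Exchanging coordinate [l] with a position [i0] of a nonzero entry factors the flattening as its
    column through [i0] times a row. *)
Lemma exchange_flattening (R : realType) (X : tensor R) :
  exchange X -> forall l, (\rank (flattening X l) <= 1)%N.
Proof.
move=> exX l; have [X0|/zero_tensorPn[i0 Xi0]] := pselect (zero_tensor X).
  rewrite (_ : flattening X l = 0) ?mxrank0 //.
  by apply/matrixP => a c; rewrite !mxE X0.
have -> : flattening X l = (\col_a X (dfwith i0 a)) *m
    (\row_c (X (dfwith (enum_val c : {dffun _}) (i0 l)) / X i0)).
  apply/matrixP => a c; rewrite !mxE big_ord1 !mxE mulrA.
  rewrite -[LHS](mulfK Xi0); congr (_ / _).
  by rewrite [LHS](exX l) dfwith_dfwith dfwith_in mulrC.
exact: leq_trans (mxrankM_maxl _ _) (rank_leq_col _).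
Qed.

Lemma flattening_exchange (R : realType) (X : tensor R) :
  (forall l, \rank (flattening X l) <= 1)%N -> exchange X.
Proof.
move=> rk1 l i j; rewrite -{1}(dfwith_id i l) -{1}(dfwith_id j l) -!flatteningE.
by rewrite mxrank_le1_minor // mulrC.
Qed.

(** * The flattening rank satisfies the axioms *)

Lemma flattening_rank_eq0 (R : realType) (X : tensor R) :
  flattening_rank X = 0%N <-> zero_tensor X.
Proof.
split=> [X0 i|X0].
  have := le_flattening_rank (Ordinal (tdeg_gt0 X)).
  rewrite X0 leqn0 mxrank_eq0 => /eqP/matrixP/(_ (i _) (column_of i)).
  by rewrite flatteningE mxE dfwith_id.
apply/eqP; rewrite -leqn0; apply: flattening_rank_le => l.
rewrite (_ : flattening X l = 0) ?mxrank0 //.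
by apply/matrixP => a c; rewrite !mxE X0.
Qed.

Lemma flattening_rank_eq1 (R : realType) (X : tensor R) :
  flattening_rank X = 1%N <-> rank_one_tensor X.
Proof.
split=> [X1|X1].
  apply: exchange_rank_one; first by move/flattening_rank_eq0; rewrite X1.
  by apply: flattening_exchange => l; rewrite -X1 le_flattening_rank.
apply/eqP; rewrite eqn_leq flattening_rank_le; last first.
  exact/exchange_flattening/rank_one_exchange.
rewrite lt0n; apply/eqP => /flattening_rank_eq0; exact: rank_one_neq0.
Qed.

Lemma flattening_rank_identity (R : realType) (m n : nat)
    (m_gt0 : (0 < m)%N) (n_gt0 : (0 < n)%N) : (2 <= m)%N ->
  flattening_rank (identity_tensor R m_gt0 n_gt0) = n.
Proof.
move=> m_gt1; set X := identity_tensor _ _ _.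
apply/eqP; rewrite eqn_leq flattening_rank_le /=; last first.
  by move=> l; rewrite rank_leq_row.
apply: leq_trans (@le_flattening_rank _ X (Ordinal m_gt0)).
rewrite -{1}(mxrank1 R n).
(* The columns at the constant positions form an identity matrix: when mode 0 is changed to [a],
   mode 1 still holds [b], so the entry is 1 exactly when [a] equals [b]. *)
apply: (@mxrank_le_flattening _ X (Ordinal m_gt0) _ _ _ id (fun b => fun=> b)).
move=> a b; rewrite mxE /=; congr (_%:R); congr nat_of_bool.
apply/eqP/forallP => [-> k|eq_ab].
  have const_b (j : 'I_m) :
      @dfwith _ (fun=> 'I_n) (fun=> b) (Ordinal m_gt0) b j = b by case: dfwithP.
  by apply/forallP => l; rewrite !const_b.
have /forallP/(_ (Ordinal m_gt1))/eqP := eq_ab (Ordinal m_gt0).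
by rewrite dfwith_in dfwith_out.
Qed.

(** Up to repeated columns, the flattenings along [l0] and [l1] are [A] and its transpose; every
    other flattening has a single row. *)
Lemma flattening_rank_matrix (R : realType) (X : tensor R) (l0 l1 : 'I_(tdeg X))
      (A : 'M[R]_(tdim X l0, tdim X l1)) :
    l0 = 0%N :> nat -> l1 = 1%N :> nat ->
    (forall l : 'I_(tdeg X), (2 <= l)%N -> tdim X l = 1%N) ->
    (forall i, X i = A (i l0) (i l1)) ->
  flattening_rank X = \rank A.
Proof.
move=> l00 l11 dim1 XA.
have l01 : l0 != l1 by apply/eqP => /(congr1 val) /=; rewrite l00 l11.
have zdim l : (0 < tdim X l)%N := tdim_gt0 X l.
pose i0 : position X := fun l => Ordinal (zdim l).
apply/eqP; rewrite eqn_leq; apply/andP; split; last first.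
  apply: leq_trans (le_flattening_rank l0).
  apply: (mxrank_le_flattening (f := id) (g := fun b => dfwith i0 b)) => a b.
  by rewrite XA dfwith_in dfwith_out // dfwith_in.
apply: flattening_rank_le => l.
case: (eqVneq l0 l) => [<-|l0l].
  apply: (@mxrank_le_entries _ _ _ _ _ _ _ id
            (fun c => (enum_val c : {dffun _}) l1)) => a c.
  by rewrite mxE XA dfwith_in dfwith_out.
case: (eqVneq l1 l) => [<-|l1l].
  rewrite -(mxrank_tr A).
  apply: (@mxrank_le_entries _ _ _ _ _ _ _ id
            (fun c => (enum_val c : {dffun _}) l0)) => a c.
  by rewrite mxE XA dfwith_in dfwith_out 1?eq_sym // mxE.
(* A single row has rank at most 1, which suffices unless [A] vanishes; then the flattening vanishes
   too. *)
have [A0|] := posnP (\rank A); last first.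
  apply: leq_trans; apply: leq_trans (rank_leq_row _) _; rewrite dim1 //.
  have : val l != val l0 by rewrite (inj_eq val_inj) eq_sym.
  have : val l != val l1 by rewrite (inj_eq val_inj) eq_sym.
  by rewrite /= l00 l11; case: (val l) => [|[]].
rewrite (_ : flattening X l = 0) ?mxrank0 //.
have /eqP {}A0 : A == 0 by rewrite -mxrank_eq0 A0.
by apply/matrixP => a c; rewrite !mxE XA A0 mxE.
Qed.

Lemma flattening_rank_scale (R : realType) (a : R) (X : tensor R) : a != 0 ->
  flattening_rank (scale_tensor a X) = flattening_rank X.
Proof.
move=> a0; apply: eq_bigr => l _.
have -> : flattening (scale_tensor a X) l = a *: flattening X l.
  by apply/matrixP => b c; rewrite !mxE.
exact: mxrank_scale_nz.
Qed.

Lemma flattening_rank_permute_le (R : realType) (X : tensor R) (s : 'S_(tdeg X)) :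
  (flattening_rank (permute_modes s) <= flattening_rank X)%N.
Proof.
apply: flattening_rank_le => l; apply: leq_trans (le_flattening_rank (s l)).
pose back (c : 'I_#|{dffun forall k : 'I_(tdeg X), 'I_(tdim X (s k))}|) :
  position X := fun k => cast_ord (congr1 (tdim X) (permKV s k))
                   ((enum_val c : {dffun _}) ((s^-1)%g k)).
apply: (mxrank_le_flattening (f := id) (g := back)) => a c.
rewrite mxE /=; congr (tentry X _); apply: functional_extensionality_dep => k.
case: (eqVneq (s l) k) => [<-|slk]; last first.
  rewrite !dfwith_out // /back.
  by apply: contra_neq slk => ->; rewrite permKV.
rewrite dfwith_in; apply: val_inj => /=.
set i := dfwith _ _.
rewrite (congr1 (fun k => i k : nat) (permK s l)).
by rewrite /i dfwith_in.
Qed.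

Lemma flattening_rank_permute (R : realType) (X : tensor R) (s : 'S_(tdeg X)) :
  flattening_rank (permute_modes s) = flattening_rank X.
Proof.
apply/eqP; rewrite eqn_leq flattening_rank_permute_le /=.
rewrite -{1}(permute_modesK s); exact: flattening_rank_permute_le.
Qed.

Lemma flattening_rank_subtensor (R : realType) (X Y : tensor R) :
  is_subtensor Y X -> (flattening_rank Y <= flattening_rank X)%N.
Proof.
move=> [S [S0 ->]]; apply: flattening_rank_le => l.
apply: leq_trans (le_flattening_rank (l : 'I_(tdeg X))).
apply: (mxrank_le_flattening (f := @enum_val _ (mem (S l)))
  (g := fun c k => enum_val ((enum_val c : {dffun _}) k))) => a c.
rewrite mxE /=; congr (tentry X _); apply: functional_extensionality_dep => k.
by case: (eqVneq l k) => [<-|lk]; rewrite ?dfwith_in ?dfwith_out.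
Qed.

Lemma flattening_rank_trf (R : realType) :
  tensor_rank_function (@flattening_rank R).
Proof.
split.
- exact: flattening_rank_eq0.
- exact: flattening_rank_eq1.
- exact: flattening_rank_identity.
- exact: flattening_rank_matrix.
- exact: flattening_rank_scale.
- exact: flattening_rank_permute.
- exact: flattening_rank_subtensor.
Qed.

(** * The smallest rank and full rank subtensors *)

Lemma smallest_rankP (R : realType) (X : tensor R) :
  (exists r, tensor_rank_function r /\ r X = smallest_rank X) /\
  (forall r, tensor_rank_function r -> (smallest_rank X <= r X)%N).
Proof.
rewrite /smallest_rank; case: xgetP => [k _ [//]|no_min].
have ex_k : exists k, `[<exists r, tensor_rank_function r /\ r X = k>].
  exists (flattening_rank X); apply/asboolP; exists (@flattening_rank R).
  by split=> //; exact: flattening_rank_trf.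
case: (ex_minnP ex_k) => k /asboolP rk k_min; case: (no_min k); split=> // r tr.
by apply: k_min; apply/asboolP; exists r.
Qed.

(** Evaluate the comparison at a rank function attaining the minimum at [Y]. The axioms relating two
    tensors pass to the minimum this way; those about one tensor are read off a rank function
    attaining the minimum there. *)
Lemma smallest_rank_le (R : realType) (X Y : tensor R) :
  (forall r, tensor_rank_function r -> (r X <= r Y)%N) ->
  (smallest_rank X <= smallest_rank Y)%N.
Proof.
move=> le_XY; have [[r [tr <-]] _] := smallest_rankP Y.
by apply: leq_trans (le_XY r tr); exact: (smallest_rankP X).2.
Qed.

Lemma smallest_rank_trf (R : realType) :
  tensor_rank_function (@smallest_rank R).
Proof.
split=> [X|X|m n m0 n0 m2|X l0 l1 A l00 l11 X1 XA|a X a0|X s|X Y YX].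
- by have [[r [tr <-]] _] := smallest_rankP X; exact: trf_zero.
- by have [[r [tr <-]] _] := smallest_rankP X; exact: trf_one.
- have [[r [tr <-]] _] := smallest_rankP (identity_tensor R m0 n0).
  exact: trf_identity.
- by have [[r [tr <-]] _] := smallest_rankP X; apply: trf_matrix XA.
- by apply/eqP; rewrite eqn_leq; apply/andP; split; apply: smallest_rank_le => r tr;
    rewrite trf_scale.
- by apply/eqP; rewrite eqn_leq; apply/andP; split; apply: smallest_rank_le => r tr;
    rewrite trf_permute.
- by apply: smallest_rank_le => r tr; exact: trf_subtensor.
Qed.

(** Not every tensor rank function has this bound: a real 2 x 2 x 2 tensor can have CP rank 3. The
    bound is what makes suitable small subtensors full rank. *)
Definition dim_bounded (R : realType) (r : tensor R -> nat) : Prop :=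
  forall X n, (forall l, (tdim X l <= n)%N) -> (r X <= n)%N.

Lemma smallest_rank_dim_bounded (R : realType) : dim_bounded (@smallest_rank R).
Proof.
move=> X n le_n; apply: leq_trans ((smallest_rankP X).2 _ (flattening_rank_trf R)) _.
apply: flattening_rank_le => l; exact: leq_trans (rank_leq_row _) (le_n l).
Qed.

(** Under a dimension-bounded rank function such a subtensor has rank 0 or 1, hence full rank; it
    provides a first candidate in every tensor. *)
Lemma unit_subtensor (R : realType) (X : tensor R) (i : position X) :
  exists Y, [/\ is_subtensor Y X, forall l, tdim Y l = 1%N & exists j, Y j = X i].
Proof.
have S0 l : [set i l] != set0 by apply/set0Pn; exists (i l); rewrite set11.
exists (subtensor S0); split=> [|l|]; first by exists (fun l => [set i l]), S0.
  by rewrite /= cards1.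
exists (fun l => enum_rank_in (set11 (i l)) (i l)).
congr (tentry X _); apply: functional_extensionality_dep => l.
by rewrite enum_rankK_in ?set11.
Qed.

(* Not being rank one is witnessed by a failure of the exchange identity, which
   involves two positions only. *)
Lemma not_rank_one_subtensor (R : realType) (X : tensor R) :
  ~ zero_tensor X -> ~ rank_one_tensor X ->
  exists Y, [/\ is_subtensor Y X, forall l, (tdim Y l <= 2)%N,
    exists l, tdim Y l = 2%N, ~ zero_tensor Y & ~ rank_one_tensor Y].
Proof.
move=> X0 X1; have /existsNP[l /existsNP[i /existsNP[j Xij]]] : ~ exchange X.
  by move=> exX; exact/X1/exchange_rank_one.
pose S k := [set i k; j k].
have iS k : i k \in S k by rewrite !inE eqxx.
have jS k : j k \in S k by rewrite !inE eqxx orbT.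
have S0 k : S k != set0 by apply/set0Pn; exists (i k); exact: iS.
pose Y := subtensor S0.
have YN : ~ exchange Y.
  move=> /(_ l (fun k => enum_rank_in (iS k) (i k))
               (fun k => enum_rank_in (jS k) (j k))) exY; apply: Xij.
  have -> : X i = Y (fun k => enum_rank_in (iS k) (i k)).
    congr (tentry X _); apply: functional_extensionality_dep => k.
    by rewrite enum_rankK_in ?iS.
  have -> : X j = Y (fun k => enum_rank_in (jS k) (j k)).
    congr (tentry X _); apply: functional_extensionality_dep => k.
    by rewrite enum_rankK_in ?jS.
  rewrite exY; congr (tentry X _ * tentry X _);
    apply: functional_extensionality_dep => k; case: (eqVneq l k) => [<-|lk];
    by rewrite ?dfwith_in ?dfwith_out // enum_rankK_in ?iS ?jS.
exists Y; split.
- by exists S, S0.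
- by move=> k; rewrite /= cards2; case: eqP.
(* If [i] and [j] agreed at [l], the exchange would change nothing and its identity could not
   fail. *)
- exists l; rewrite /= cards2; case: eqVneq => // ij.
  by case: Xij; rewrite -{1}ij dfwith_id ij dfwith_id.
- by move=> Y0; apply: YN => k a b; rewrite !Y0 !mul0r.
- by move=> /rank_one_exchange.
Qed.

(** * The largest rank of a full rank subtensor *)

Definition full_subrank (R : realType) (r : tensor R -> nat) (X : tensor R) : nat :=
  xget 0%N [set k | exists Y, max_full_rank_subtensor r X Y /\ k = r Y]%classic.

(** The ranks of full rank subtensors form a set that is nonempty, by a subtensor with a single
    entry, and bounded by [r X]. So the maximum exists and the default value 0 of [xget] is never
    taken. *)
Lemma full_subrankP (R : realType) (r : tensor R -> nat) (X : tensor R) :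
  tensor_rank_function r -> dim_bounded r ->
  exists Y, max_full_rank_subtensor r X Y /\ full_subrank r X = r Y.
Proof.
move=> tr rb; rewrite /full_subrank; case: xgetP => [k _ //|no_max].
have ex_k : exists k, `[<exists Y, [/\ is_subtensor Y X, full_rank r Y & r Y = k]>].
  have [Y [YX Y1 _]] := unit_subtensor (fun l => Ordinal (tdim_gt0 X l)).
  exists (r Y); apply/asboolP; exists Y; split=> //.
  have : (r Y <= 1)%N by apply: rb => l; rewrite Y1.
  case rY: (r Y) => [|[|//]] _; first by right; apply/(trf_zero tr).
  by left; exists (Ordinal (tdeg_gt0 Y)); rewrite rY Y1.
have k_le k : `[<exists Y, [/\ is_subtensor Y X, full_rank r Y & r Y = k]>] ->
    (k <= r X)%N.
  by move=> /asboolP[Y [YX _ <-]]; exact: trf_subtensor.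
case: (ex_maxnP ex_k k_le) => k /asboolP[Y [YX Yf rY]] k_max.
case: (no_max (r Y)); exists Y; do 2 split=> //; move=> Z ZX Zf; rewrite rY; apply: k_max.
by apply/asboolP; exists Z.
Qed.

Lemma le_full_subrank (R : realType) (r : tensor R -> nat) (X Z : tensor R) :
  tensor_rank_function r -> dim_bounded r ->
  is_subtensor Z X -> full_rank r Z -> (r Z <= full_subrank r X)%N.
Proof.
by move=> tr rb ZX Zf; have [Y [[_ _ Ymax] ->]] := full_subrankP X tr rb; exact: Ymax.
Qed.

Lemma full_subrank_le (R : realType) (r : tensor R -> nat) (X : tensor R) :
  tensor_rank_function r -> dim_bounded r -> (full_subrank r X <= r X)%N.
Proof.
move=> tr rb; have [Y [[YX _ _] ->]] := full_subrankP X tr rb.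
exact: trf_subtensor.
Qed.

Lemma full_subrank_eq0 (R : realType) (r : tensor R -> nat) (X : tensor R) :
  tensor_rank_function r -> dim_bounded r ->
  full_subrank r X = 0%N <-> zero_tensor X.
Proof.
move=> tr rb; split=> [X0|/(trf_zero tr) rX]; last first.
  by apply/eqP; rewrite -leqn0 -rX full_subrank_le.
apply: contrapT => /zero_tensorPn[i Xi].
have [Y [YX Y1 [j Yj]]] := unit_subtensor i.
have rY : r Y = 1%N.
  have : (r Y <= 1)%N by apply: rb => l; rewrite Y1.
  case rY: (r Y) => [|[|//]] // _; move/(trf_zero tr): rY => /(_ j).
  by rewrite Yj => Xi0; rewrite Xi0 eqxx in Xi.
have : (r Y <= full_subrank r X)%N.
  apply: le_full_subrank => //; left; exists (Ordinal (tdeg_gt0 Y)).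
  by rewrite rY Y1.
by rewrite rY X0.
Qed.

Lemma full_subrank_eq1 (R : realType) (r : tensor R -> nat) (X : tensor R) :
  tensor_rank_function r -> dim_bounded r ->
  full_subrank r X = 1%N <-> rank_one_tensor X.
Proof.
move=> tr rb; split=> [X1|X1]; last first.
  apply/eqP; rewrite eqn_leq -{1}((trf_one tr X).2 X1) full_subrank_le //=.
  rewrite lt0n; apply/eqP => /(full_subrank_eq0 _ tr rb); exact: rank_one_neq0.
apply: contrapT => /not_rank_one_subtensor[|Y [YX Y2 [l Yl] Y0 YN]].
  by move=> /(full_subrank_eq0 _ tr rb); rewrite X1.
have rY : r Y = 2%N.
  have : (r Y <= 2)%N by exact: rb.
  case rY: (r Y) => [|[|[|]]] // _.
    by case: Y0; apply/(trf_zero tr).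
  by case: YN; apply/(trf_one tr).
have : (r Y <= full_subrank r X)%N.
  by apply: le_full_subrank => //; left; exists l; rewrite rY Yl.
by rewrite rY X1.
Qed.

(** Keeping a maximal independent family of rows of [A] and all columns gives a subtensor with as
    many rows as its rank, hence of full rank. *)
Lemma full_subrank_matrix (R : realType) (r : tensor R -> nat) (X : tensor R)
    (l0 l1 : 'I_(tdeg X)) (A : 'M[R]_(tdim X l0, tdim X l1)) :
    tensor_rank_function r -> dim_bounded r ->
    l0 = 0%N :> nat -> l1 = 1%N :> nat ->
    (forall l : 'I_(tdeg X), (2 <= l)%N -> tdim X l = 1%N) ->
    (forall i, X i = A (i l0) (i l1)) ->
  full_subrank r X = \rank A.
Proof.
move=> tr rb l00 l11 X1 XA.
apply/eqP; rewrite eqn_leq -{1}(trf_matrix tr l00 l11 X1 XA) full_subrank_le //=.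
(* Rank 0 would select no row, whereas the index sets of a subtensor are nonempty. *)
have [->//|A_gt0] := posnP (\rank A).
pose rows := [set maxrankfun A x | x in 'I_(\rank A)].
pose S : forall l, {set 'I_(tdim X l)} :=
  dfwith (fun l => [set: 'I_(tdim X l)]) (rows : {set 'I_(tdim X l0)}).
have Sl0 : S l0 = rows by rewrite /S dfwith_in.
have ST l : l0 != l -> S l = [set: 'I_(tdim X l)] by move=> ?; rewrite /S dfwith_out.
have S0 l : S l != set0.
  case: (eqVneq l0 l) => [<-|/ST ->].
    rewrite Sl0; apply/set0Pn; exists (maxrankfun A (Ordinal A_gt0)).
    exact: imset_f.
  by apply/set0Pn; exists (Ordinal (tdim_gt0 X l)); rewrite in_setT.
have l01 : l0 != l1 by apply/eqP => /(congr1 val) /=; rewrite l00 l11.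
have rowS x : maxrankfun A x \in S l0 by rewrite Sl0 imset_f.
have colS y : y \in S l1 by rewrite ST ?in_setT.
pose B : 'M_(#|S l0|, #|S l1|) := \matrix_(a, b) A (enum_val a) (enum_val b).
have rB : \rank B = \rank A.
  apply/eqP; rewrite eqn_leq; apply/andP; split.
    by apply: (mxrank_le_entries (f := enum_val) (g := enum_val)) => a b; rewrite mxE.
  rewrite -{1}(eq_maxrowsub A); have [y _] := set0Pn _ (S0 l1).
  apply: (mxrank_le_entries
    (f := fun x => enum_rank_in (rowS x) (maxrankfun A x))
    (g := fun z => enum_rank_in (colS z) z)) => x z.
  by rewrite !mxE !enum_rankK_in.
have rY : r (subtensor S0) = \rank A.
  rewrite -rB; apply: (@trf_matrix _ _ tr (subtensor S0) l0 l1 B) => //.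
    move=> l l2; rewrite /= ST ?cardsT ?card_ord ?X1 //.
    by apply: contraTneq l2 => <-; rewrite l00.
  by move=> i; rewrite /= XA mxE.
rewrite -rY; apply: le_full_subrank => //; first by exists S, S0.
left; exists l0; rewrite rY /= Sl0 card_imset ?card_ord //.
exact: maxrankfun_inj.
Qed.

(** Scaling carries full rank subtensors of [X] to full rank subtensors of the scaled tensor. The
    reverse inequality is this one for the inverse scalar; permutations of modes are treated
    alike. *)
Lemma full_subrank_scale_le (R : realType) (r : tensor R -> nat) (a : R)
    (X : tensor R) :
  tensor_rank_function r -> dim_bounded r -> a != 0 ->
  (full_subrank r X <= full_subrank r (scale_tensor a X))%N.
Proof.
move=> tr rb a0; have [Y [[YX Yf _] ->]] := full_subrankP X tr rb.
rewrite -(trf_scale tr Y a0).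
apply: le_full_subrank => //; first exact: is_subtensor_scale.
case: Yf => [[p rY]|Y0]; last by right=> i /=; rewrite Y0 mulr0.
by left; exists p; rewrite trf_scale.
Qed.

Lemma full_subrank_permute_le (R : realType) (r : tensor R -> nat)
    (X : tensor R) (s : 'S_(tdeg X)) :
  tensor_rank_function r -> dim_bounded r ->
  (full_subrank r X <= full_subrank r (permute_modes s))%N.
Proof.
move=> tr rb; have [_ [[[S [S0 ->]] Yf _] ->]] := full_subrankP X tr rb.
rewrite -(@trf_permute _ _ tr (subtensor S0) s).
apply: le_full_subrank => //; first exact: is_subtensor_permute.
case: Yf => [[p rY]|Y0]; last by right=> i; exact: Y0.
(* Mode [l] of the permuted tensor is mode [s l] of the original, so mode [p] is found at its
   preimage. *)
by left; exists ((s^-1)%g p); rewrite trf_permute // rY /= permKV.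
Qed.

Lemma full_subrank_trf (R : realType) (r : tensor R -> nat) :
  tensor_rank_function r -> dim_bounded r -> tensor_rank_function (full_subrank r).
Proof.
move=> tr rb; split=> [X|X|m n m0 n0 m2|X l0 l1 A l00 l11 X1 XA|a X a0|X s|X Y YX].
- exact: full_subrank_eq0.
- exact: full_subrank_eq1.
- have rI : r (identity_tensor R m0 n0) = n by exact: trf_identity.
  rewrite -[RHS]rI; apply/eqP; rewrite eqn_leq full_subrank_le //=.
  (* The identity tensor is itself of full rank, its rank being its common dimension. *)
  apply: le_full_subrank => //; first exact: is_subtensor_refl.
  by left; exists (Ordinal m0); rewrite rI.
- exact: full_subrank_matrix XA.
- apply/eqP; rewrite eqn_leq full_subrank_scale_le // andbT.
  by rewrite -{2}(scale_tensorK X a0) full_subrank_scale_le ?invr_eq0.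
- apply/eqP; rewrite eqn_leq full_subrank_permute_le // andbT.
  by rewrite -{2}(permute_modesK s) full_subrank_permute_le.
- have [Z [[ZY Zf _] ->]] := full_subrankP Y tr rb.
  by apply: le_full_subrank => //; exact: is_subtensor_trans YX.
Qed.

Theorem corollary5p4 (R : realType) :
  max_full_rank_subtensor_property (@smallest_rank R).
Proof.
have tr := smallest_rank_trf R; have rb := @smallest_rank_dim_bounded R.
move=> X; have [Y [maxY rY]] := full_subrankP X tr rb; exists Y; split=> //.
rewrite -rY; apply/eqP; rewrite eqn_leq full_subrank_le // andbT.
exact: (smallest_rankP X).2 _ (full_subrank_trf tr rb).
Qed.
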